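(* Let $(a_n)_{n\geqslant 1}$ be a sequence of positive real numbers and $(r_n)_{n\geqslant 1}$ a sequence of positive integers. Let $v_n=\sqrt[r_1]{a_{1}+\sqrt[r_2]{a_2+\cdots+\sqrt[r_n]{a_n}}}$ for $n\geqslant 1$, and define functions $f_k$ by $f_0(y)=y$ and $f_k(y)=f_{k-1}(y)^{r_k}-a_k$ for $k\geqslant 1$. Then for every $n\geqslant 1$, $$v_{n+1}-v_n \leqslant \frac{\sqrt[r_{n+1}]{a_{n+1}}}{\prod_{i=1}^{n}r_i\, (f_{i-1}(v_n))^{r_i-1}}.$$
   Context: The number $v_n$ is the $n$-th approximant of the continued (right) radical $\sqrt[r_1]{a_{1}+\sqrt[r_2]{a_2+\sqrt[r_3]{a_3+\cdots}}}$; it is computed from the inside out: start with $\sqrt[r_n]{a_n}$ and successively, for $i=n-1,n-2,\ldots,1$, add $a_i$ and take the (nonnegative real) $r_i$-th root. The product in the denominator is over the whole expression $r_i (f_{i-1}(v_n))^{r_i-1}$, $i=1,\ldots,n$. *)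

(* Defs.v *)
From mathcomp Require Import all_boot all_order all_algebra.
From mathcomp Require Import reals exp.

Set Implicit Arguments.
Unset Strict Implicit.
Unset Printing Implicit Defensive.
Import Order.TTheory GRing.Theory Num.Theory.
Local Open Scope ring_scope.

(* For 0 < k and 0 <= x this is the unique y >= 0 such that y ^+ k = x. *)
Definition real_root (R : realType) (k : nat) (x : R) : R :=
  powR x (k%:R^-1).

(* The finite right radical whose outermost index is i and innermost index is
   i + k. *)
Fixpoint radical (R : realType) (a : nat -> R) (r : nat -> nat) (i k : nat) : R :=
  match k with
  | 0 => real_root (r i) (a i)
  | k'.+1 => real_root (r i) (a i + radical a r i.+1 k')
  end.

(* Sequences are indexed from 1: only the values for n >= 1 are meaningful. *)
Definition approximant (R : realType) (a : nat -> R) (r : nat -> nat) (n : nat) : R :=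
  radical a r 1 n.-1.

Fixpoint unfold_radical (R : realType) (a : nat -> R) (r : nat -> nat)
    (k : nat) (y : R) : R :=
  match k with
  | 0 => y
  | k'.+1 => unfold_radical a r k' y ^+ r k'.+1 - a k'.+1
  end.

(* Main.v *)
Require Import Defs.
From mathcomp Require Import all_boot all_order all_algebra.
From mathcomp Require Import reals exp.
From mathcomp Require Import ring.

(* Write [R_i] for the tail of [v_n] starting at index [i] and [R'_i] for that of
   [v_(n+1)], so that [R_i ^ r_i = a_i + R_(i+1)].  Convexity of [x ^ r] gives
   [r_i R_i ^ (r_i - 1) (R'_i - R_i) <= R'_i ^ r_i - R_i ^ r_i = R'_(i+1) - R_(i+1)],
   and this telescopes down to the innermost root of [a_(n+1)].  Finally
   [f_(i-1) (v_n) = R_i]. *)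

Set Implicit Arguments.
Unset Strict Implicit.
Unset Printing Implicit Defensive.
Import Order.TTheory GRing.Theory Num.Theory.
Local Open Scope ring_scope.

(** Induction on [m]: passing to the next exponent multiplies the gap between the two sides by [x]
    and adds a nonnegative multiple of [(x - y) ^+ 2]. *)
Lemma exprn_tangent_le (R : realDomainType) (m : nat) (x y : R) :
  0 <= x -> 0 <= y ->
  m.+1%:R * y ^+ m * (x - y) <= x ^+ m.+1 - y ^+ m.+1.
Proof.
move=> x0 y0; elim: m => [|m IH]; first by rewrite expr0 !expr1 !mul1r.
rewrite -subr_ge0.
have -> : x ^+ m.+2 - y ^+ m.+2 - m.+2%:R * y ^+ m.+1 * (x - y) =
  x * (x ^+ m.+1 - y ^+ m.+1 - m.+1%:R * y ^+ m * (x - y)) +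
  m.+1%:R * y ^+ m * (x - y) ^+ 2.
  by rewrite -[m.+2%:R]natr1 !exprS; ring.
by apply: addr_ge0; apply: mulr_ge0;
  rewrite ?sqr_ge0 ?subr_ge0 ?mulr_ge0 ?exprn_ge0 ?ler0n.
Qed.

Section Radical.
Variables (R : realType) (a : nat -> R) (r : nat -> nat).
Hypothesis a_gt0 : forall n, (1 <= n)%N -> 0 < a n.
Hypothesis r_gt0 : forall n, (1 <= n)%N -> (0 < r n)%N.

Lemma real_rootK (k : nat) (x : R) :
  (0 < k)%N -> 0 <= x -> real_root k x ^+ k = x.
Proof.
move=> k0 x0; rewrite /real_root -powR_mulrn ?powR_ge0 // -powRrM.
by rewrite mulVf ?powRr1 // pnatr_eq0 -lt0n.
Qed.

Lemma radical_gt0 (i k : nat) : (1 <= i)%N -> 0 < radical a r i k.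
Proof.
elim: k i => [|k IH] i i1 /=; apply: powR_gt0; first exact: a_gt0.
by rewrite addr_gt0 ?a_gt0 ?IH.
Qed.

Lemma radical0K (i : nat) : (1 <= i)%N -> radical a r i 0 ^+ r i = a i.
Proof. by move=> i1; rewrite real_rootK ?r_gt0 ?ltW ?a_gt0. Qed.

Lemma radicalSK (i k : nat) : (1 <= i)%N ->
  radical a r i k.+1 ^+ r i = a i + radical a r i.+1 k.
Proof.
by move=> i1; rewrite real_rootK ?r_gt0 ?ltW // addr_gt0 ?a_gt0 ?radical_gt0.
Qed.

(** Each step of [unfold_radical] undoes the outermost root and removes its [a] term, so [m] steps
    strip [m] layers. *)
Lemma unfold_radicalE (m k : nat) :
  unfold_radical a r m (radical a r 1 (m + k)) = radical a r m.+1 k.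
Proof.
elim: m k => [//|m IH] k.
by rewrite addSnnS /= IH radicalSK // addrC addKr.
Qed.

Lemma radical_tangent_le (i k l : nat) : (1 <= i)%N ->
  (r i)%:R * radical a r i k ^+ (r i).-1 * (radical a r i l - radical a r i k)
    <= radical a r i l ^+ r i - radical a r i k ^+ r i.
Proof.
move=> i1; have := r_gt0 i1; case: (r i) => // m _.
by apply: exprn_tangent_le; rewrite ltW ?radical_gt0.
Qed.

(** The start [i] varies so that the induction can pass to the tail at [i.+1]. The depth [i + k - j]
    makes every tail in the product end at the same index [i + k]. *)
Lemma radical_increment_le (i k : nat) : (1 <= i)%N ->
  radical a r i k.+1 - radical a r i k <=
    real_root (r (i + k).+1) (a (i + k).+1) /
    \prod_(i <= j < (i + k).+1)
      ((r j)%:R * radical a r j (i + k - j) ^+ (r j).-1).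
Proof.
elim: k i => [|k IH] i i1.
  rewrite addn0 big_nat1 subnn ler_pdivlMr; last first.
    by rewrite mulr_gt0 ?ltr0n ?r_gt0 ?exprn_gt0 ?radical_gt0.
  rewrite mulrC (le_trans (radical_tangent_le _ _ i1)) //.
  by rewrite radicalSK // radical0K // addrC addKr.
(* The factor [j = i] is split off and moved to the left, where the tangent bound applies. *)
rewrite big_ltn ?ltnS ?leq_addr // addKn invfM mulrCA mulrC.
rewrite ler_pdivlMr; last first.
  by rewrite mulr_gt0 ?ltr0n ?r_gt0 ?exprn_gt0 ?radical_gt0.
rewrite mulrC (le_trans (radical_tangent_le _ _ i1)) //.
(* The two copies of [a i] cancel, leaving the increment of the tails from [i.+1]. *)
rewrite !radicalSK // opprD addrACA subrr add0r -addSnnS.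
exact: IH.
Qed.

End Radical.

Theorem theorem2p1 (R : realType) (a : nat -> R) (r : nat -> nat)
  (ha : forall n : nat, (1 <= n)%N -> 0 < a n)
  (hr : forall n : nat, (1 <= n)%N -> (0 < r n)%N)
  (n : nat) (hn : (1 <= n)%N) :
  approximant a r n.+1 - approximant a r n <=
    real_root (r n.+1) (a n.+1) /
    \prod_(1 <= i < n.+1)
      ((r i)%:R * unfold_radical a r i.-1 (approximant a r n) ^+ (r i).-1).
Proof.
case: n hn => // n _; rewrite /approximant /=.
have := radical_increment_le ha hr n (leqnn 1); rewrite add1n.
congr (_ <= _ / _); apply: eq_big_nat => -[//|i] /andP[_ lt_in].
(* Writing [n] as [i + (n - i)] exposes the [i] layers to be stripped. *)
by rewrite /= subSS -[in RHS](subnKC (lt_in : (i <= n)%N)) unfold_radicalE.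
Qed.
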